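(* Let $\mathbf{H}$ be a bicartesian closed category. Then $\mathbf{H}_{\pm}$, with the tensor product $\boxtimes$, internal hom $\multimap$ and dualizing object $\bot$ given in the context, is a semicartesian $\ast$-autonomous category.
   Context: A bicartesian closed category is a cartesian closed category with finite coproducts. Notation in $\mathbf H$: $\wedge$ for binary products, $\vee$ for binary coproducts, $\mathbf 1$ and $\mathbf 0$ for the terminal and initial objects, $\to$ for exponentials. $\mathbf{H}_{\pm}$ is the full subcategory of $\mathbf{H}\times\mathbf{H}^{\mathrm{op}}$ determined by the pairs $P=(P^+,P^-)$ such that $P^+\wedge P^-$ is initial (equivalently, there exists a morphism $P^+\wedge P^-\to\mathbf 0$). A morphism $P\to Q$ is a pair of morphisms $P^+\to Q^+$ and $Q^-\to P^-$ in $\mathbf H$. A $\ast$-autonomous category is a closed symmetric monoidal category $(\mathbf L,\boxtimes,\multimap)$ equipped with an object $\bot$ such that for every $P$ the double-dualization map $P\to (P\multimap\bot)\multimap\bot$ is an isomorphism. It is semicartesian if its monoidal unit is also a terminal object. The structure on $\mathbf{H}_{\pm}$ is (with the evident action on morphisms): unit $\top=(\mathbf 1,\mathbf 0)$, dualizing object $\bot=(\mathbf 0,\mathbf 1)$, $$P\boxtimes Q=\bigl(P^+\wedge Q^+,\ (P^+\to Q^-)\wedge(Q^+\to P^-)\bigr),$$ $$P\multimap Q=\bigl((P^+\to Q^+)\wedge(Q^-\to P^-),\ P^+\wedge Q^-\bigr).$$ *)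

(* Defs.v *)
(* Small self-contained category theory, with Leibniz equality of morphisms.
   A cartesian or bicartesian closed category carries chosen structure. *)
From Corelib Require Import ssreflect ssrfun.

Set Implicit Arguments.
Unset Strict Implicit.
Unset Printing Implicit Defensive.

Declare Scope cat_scope.
Delimit Scope cat_scope with cat.
Local Open Scope cat_scope.

(** * Categories *)

Record category : Type := Category {
  ob :> Type;
  hom : ob -> ob -> Type;
  idm : forall A, hom A A;
  comp : forall A B C, hom B C -> hom A B -> hom A C;
  comp_idl : forall A B (f : hom A B), comp (idm B) f = f;
  comp_idr : forall A B (f : hom A B), comp f (idm A) = f;
  comp_assoc : forall A B C D (h : hom C D) (g : hom B C) (f : hom A B),
    comp h (comp g f) = comp (comp h g) f
}.

Arguments idm {c} A.
Arguments comp {c A B C} g f.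
Arguments hom {c} A B.

Notation "g ∘ f" := (comp g f)
  (at level 40, left associativity) : cat_scope.

Definition is_terminal (C : category) (T : C) : Prop :=
  forall X : C, exists! f : hom X T, True.

Definition is_initial (C : category) (I : C) : Prop :=
  forall X : C, exists! f : hom I X, True.

Definition is_iso (C : category) (A B : C) (f : hom A B) : Prop :=
  exists g : hom B A, g ∘ f = idm A /\ f ∘ g = idm B.

Definition op_cat (C : category) : category :=
  @Category C (fun A B => @hom C B A) (fun A => idm A)
    (fun A B D g f => f ∘ g)
    (fun A B f => comp_idr f) (fun A B f => comp_idl f)
    (fun A B D E h g f => esym (comp_assoc f g h)).

Section ProductCategory.
Variables C D : category.

Definition prod_hom (A B : C * D) : Type := (hom A.1 B.1 * hom A.2 B.2)%type.

Definition prod_idm (A : C * D) : prod_hom A A := (idm A.1, idm A.2).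

Definition prod_comp (A B E : C * D) (g : prod_hom B E) (f : prod_hom A B) :
  prod_hom A E := (g.1 ∘ f.1, g.2 ∘ f.2).

Lemma prod_comp_idl A B (f : prod_hom A B) : prod_comp (prod_idm B) f = f.
Proof. by case: f => f1 f2; rewrite /prod_comp !comp_idl. Qed.

Lemma prod_comp_idr A B (f : prod_hom A B) : prod_comp f (prod_idm A) = f.
Proof. by case: f => f1 f2; rewrite /prod_comp !comp_idr. Qed.

Lemma prod_comp_assoc A B E F (h : prod_hom E F) (g : prod_hom B E)
    (f : prod_hom A B) :
  prod_comp h (prod_comp g f) = prod_comp (prod_comp h g) f.
Proof. by rewrite /prod_comp !comp_assoc. Qed.

Definition prod_cat : category :=
  Category prod_comp_idl prod_comp_idr prod_comp_assoc.
End ProductCategory.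

Definition full_subcat (C : category) (S : C -> Prop) : category :=
  @Category {A : C | S A} (fun A B => hom (proj1_sig A) (proj1_sig B))
    (fun A => idm (proj1_sig A)) (fun A B D g f => g ∘ f)
    (fun A B f => comp_idl f) (fun A B f => comp_idr f)
    (fun A B D E h g f => comp_assoc h g f).

Record functor (C D : category) : Type := Functor {
  fob :> C -> D;
  fmap : forall A B : C, hom A B -> hom (fob A) (fob B);
  fmap_id : forall A, fmap (idm A) = idm (fob A);
  fmap_comp : forall A B E (g : hom B E) (f : hom A B),
    fmap (g ∘ f) = fmap g ∘ fmap f
}.

Arguments fmap {C D} F {A B} f : rename.

(** * Bicartesian closed categories *)

Record cartesian_closed_category : Type := CartesianClosed {
  ccc_cat :> category;
  one : ccc_cat;
  to_one : forall X, hom X one;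
  to_one_uniq : forall X (f : hom X one), f = to_one X;
  prd : ccc_cat -> ccc_cat -> ccc_cat;
  fst_ : forall A B, hom (prd A B) A;
  snd_ : forall A B, hom (prd A B) B;
  pairm : forall X A B, hom X A -> hom X B -> hom X (prd A B);
  fst_pairm : forall X A B (f : hom X A) (g : hom X B),
    fst_ A B ∘ pairm f g = f;
  snd_pairm : forall X A B (f : hom X A) (g : hom X B),
    snd_ A B ∘ pairm f g = g;
  pairm_uniq : forall X A B (f : hom X A) (g : hom X B) (h : hom X (prd A B)),
    fst_ A B ∘ h = f -> snd_ A B ∘ h = g -> h = pairm f g;
  (* [expo A B] is the exponential [A → B] *)
  expo : ccc_cat -> ccc_cat -> ccc_cat;
  ev : forall A B, hom (prd (expo A B) A) B;
  lam : forall X A B, hom (prd X A) B -> hom X (expo A B);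
  ev_lam : forall X A B (f : hom (prd X A) B),
    ev A B ∘ pairm (lam f ∘ fst_ X A) (snd_ X A) = f;
  lam_uniq : forall X A B (f : hom (prd X A) B) (g : hom X (expo A B)),
    ev A B ∘ pairm (g ∘ fst_ X A) (snd_ X A) = f -> g = lam f
}.

Record bicartesian_closed_category : Type := BicartesianClosed {
  bcc_ccc :> cartesian_closed_category;
  zero : bcc_ccc;
  from_zero : forall X, hom zero X;
  from_zero_uniq : forall X (f : hom zero X), f = from_zero X;
  coprd : bcc_ccc -> bcc_ccc -> bcc_ccc;
  inl_ : forall A B, hom A (coprd A B);
  inr_ : forall A B, hom B (coprd A B);
  copairm : forall X A B, hom A X -> hom B X -> hom (coprd A B) X;
  copairm_inl : forall X A B (f : hom A X) (g : hom B X),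
    copairm f g ∘ inl_ A B = f;
  copairm_inr : forall X A B (f : hom A X) (g : hom B X),
    copairm f g ∘ inr_ A B = g;
  copairm_uniq : forall X A B (f : hom A X) (g : hom B X)
      (h : hom (coprd A B) X),
    h ∘ inl_ A B = f -> h ∘ inr_ A B = g -> h = copairm f g
}.

Arguments one {c}.
Arguments to_one {c} X.
Arguments prd {c} A B.
Arguments fst_ {c A B}.
Arguments snd_ {c A B}.
Arguments pairm {c X A B} f g.
Arguments expo {c} A B.
Arguments ev {c A B}.
Arguments lam {c X A B} f.
Arguments zero {b}.
Arguments from_zero {b} X.

Notation "A ∧ B" := (prd A B) (at level 40, left associativity) : cat_scope.
Notation "A ⇒ B" := (expo A B) (at level 55, right associativity) : cat_scope.

Section CartesianClosedMaps.
Variable H : cartesian_closed_category.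
Implicit Types A B X Y : H.

Definition prdm A B A' B' (f : hom A A') (g : hom B B') :
  hom (A ∧ B) (A' ∧ B') := pairm (f ∘ fst_) (g ∘ snd_).

Definition expom A B A' B' (f : hom A' A) (g : hom B B') :
  hom (A ⇒ B) (A' ⇒ B') := lam (g ∘ ev ∘ prdm (idm _) f).

Lemma pairm_ext X A B (f g : hom X (A ∧ B)) :
  fst_ ∘ f = fst_ ∘ g -> snd_ ∘ f = snd_ ∘ g -> f = g.
Proof.
move=> e1 e2; rewrite (pairm_uniq e1 e2); symmetry.
exact: pairm_uniq.
Qed.

Lemma pairm_comp X Y A B (f : hom X A) (g : hom X B) (h : hom Y X) :
  pairm f g ∘ h = pairm (f ∘ h) (g ∘ h).
Proof. by apply: pairm_uniq; rewrite comp_assoc ?fst_pairm ?snd_pairm. Qed.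

Lemma prdm_id A B : prdm (idm A) (idm B) = idm (A ∧ B).
Proof. by symmetry; apply: pairm_uniq; rewrite comp_idl comp_idr. Qed.

Lemma prdm_comp A B A' B' A'' B'' (f' : hom A' A'') (g' : hom B' B'')
    (f : hom A A') (g : hom B B') :
  prdm (f' ∘ f) (g' ∘ g) = prdm f' g' ∘ prdm f g.
Proof.
by rewrite /prdm pairm_comp -!comp_assoc fst_pairm snd_pairm.
Qed.

Lemma ev_prdm_lam X A B (f : hom (X ∧ A) B) : ev ∘ prdm (lam f) (idm A) = f.
Proof. by rewrite /prdm comp_idl ev_lam. Qed.

Lemma lam_ext X A B (f g : hom X (A ⇒ B)) :
  ev ∘ prdm f (idm A) = ev ∘ prdm g (idm A) -> f = g.
Proof.
rewrite /prdm !comp_idl => e.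
by rewrite (lam_uniq e); symmetry; apply: lam_uniq.
Qed.

Lemma expom_id A B : expom (idm A) (idm B) = idm (A ⇒ B).
Proof. by apply: lam_ext; rewrite ev_prdm_lam comp_idl. Qed.

Lemma expom_comp A B A' B' A'' B'' (f' : hom A'' A') (g' : hom B' B'')
    (f : hom A' A) (g : hom B B') :
  expom (f ∘ f') (g' ∘ g) = expom f' g' ∘ expom f g.
Proof.
have ev_expom X Y X' Y' (u : hom X' X) (v : hom Y Y') :
    ev ∘ prdm (expom u v) (idm X') = v ∘ ev ∘ prdm (idm _) u.
  exact: ev_prdm_lam.
have split_prdm X X' Y Y' (u : hom X X') (v : hom Y Y') :
    prdm u v = prdm u (idm Y') ∘ prdm (idm X) v.
  by rewrite -prdm_comp comp_idl comp_idr.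
apply: lam_ext; rewrite ev_expom.
transitivity (g' ∘ (ev ∘ prdm (expom f g) (idm A')) ∘ prdm (idm _) f').
  by rewrite ev_expom -!comp_assoc -prdm_comp comp_idl.
rewrite -!comp_assoc -split_prdm [g' ∘ _]comp_assoc.
transitivity (ev ∘ prdm (expom f' g') (idm A'') ∘ prdm (expom f g) (idm A'')).
  by rewrite ev_expom -!comp_assoc -prdm_comp comp_idl comp_idr.
by rewrite -comp_assoc -prdm_comp comp_idl.
Qed.

End CartesianClosedMaps.

Section StrictInitial.
Variable H : bicartesian_closed_category.
Implicit Types A X : H.

Lemma initial_of_hom A : hom A (zero : H) -> is_initial A.
Proof.
move=> z X; exists (from_zero X ∘ z); split=> // f _.
pose k (h : hom A X) : hom (zero ∧ A) X := h ∘ snd_.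
have kE h : h = k h ∘ pairm z (idm A).
  by rewrite -comp_assoc snd_pairm comp_idr.
have eq_k (h h' : hom A X) : h = h'.
  rewrite (kE h) (kE h'); congr (_ ∘ _).
  rewrite -(ev_prdm_lam (k h)) -(ev_prdm_lam (k h')).
  by rewrite (from_zero_uniq (lam (k h))) (from_zero_uniq (lam (k h'))).
exact: eq_k.
Qed.

Lemma is_initial_hom A X : is_initial A -> inhabited (hom A X).
Proof. by move=> /(_ X) [f _]; exists. Qed.

Lemma zero_prd_initial A : is_initial (zero ∧ A : H).
Proof. exact: initial_of_hom fst_. Qed.

Lemma prd_zero_initial A : is_initial (A ∧ zero : H).
Proof. exact: initial_of_hom snd_. Qed.
End StrictInitial.

(** * The category [H±] *)

Section PlusMinus.
Variable H : bicartesian_closed_category.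

Definition pm_cat : category :=
  full_subcat (fun P : prod_cat H (op_cat H) => is_initial (P.1 ∧ P.2 : H)).

Definition pos (P : pm_cat) : H := (proj1_sig P).1.
Definition neg (P : pm_cat) : H := (proj1_sig P).2.

Definition pm_ob (A B : H) (dis : is_initial (A ∧ B)) : pm_cat :=
  exist (fun P : prod_cat H (op_cat H) => is_initial (P.1 ∧ P.2 : H))
    (A, B) dis.

Definition posm (P Q : pm_cat) (f : hom P Q) : hom (pos P) (pos Q) := f.1.
Definition negm (P Q : pm_cat) (f : hom P Q) : hom (neg Q) (neg P) := f.2.

Definition pm_hom (P Q : pm_cat) (f : hom (pos P) (pos Q))
  (g : hom (neg Q) (neg P)) : hom P Q := (f, g).

Definition pm_top : pm_cat := pm_ob (prd_zero_initial one).
Definition pm_bot : pm_cat := pm_ob (zero_prd_initial one).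

Lemma tensor_initial (P Q : pm_cat) :
  is_initial ((pos P ∧ pos Q) ∧ ((pos P ⇒ neg Q) ∧ (pos Q ⇒ neg P))).
Proof.
have [z] := is_initial_hom zero (proj2_sig Q).
apply: initial_of_hom; apply: (comp z).
by apply: pairm (snd_ ∘ fst_) (ev ∘ pairm (fst_ ∘ snd_) (fst_ ∘ fst_)).
Qed.

Lemma ihom_initial (P Q : pm_cat) :
  is_initial (((pos P ⇒ pos Q) ∧ (neg Q ⇒ neg P)) ∧ (pos P ∧ neg Q)).
Proof.
have [z] := is_initial_hom zero (proj2_sig Q).
apply: initial_of_hom; apply: (comp z).
by apply: pairm (ev ∘ pairm (fst_ ∘ fst_) (fst_ ∘ snd_)) (snd_ ∘ snd_).
Qed.

Definition tensor_ob (PQ : prod_cat pm_cat pm_cat) : pm_cat :=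
  pm_ob (tensor_initial PQ.1 PQ.2).

Definition tensor_map (A B : prod_cat pm_cat pm_cat) (fg : hom A B) :
    hom (tensor_ob A) (tensor_ob B) :=
  @pm_hom (tensor_ob A) (tensor_ob B)
    (prdm (posm fg.1) (posm fg.2))
    (prdm (expom (posm fg.1) (negm fg.2)) (expom (posm fg.2) (negm fg.1))).

Lemma tensor_map_id A : tensor_map (idm A) = idm (tensor_ob A).
Proof.
by rewrite /tensor_map /pm_hom /posm /negm /= !expom_id !prdm_id.
Qed.

Lemma tensor_map_comp (A B E : prod_cat pm_cat pm_cat) (g : hom B E)
    (f : hom A B) :
  tensor_map (g ∘ f) = tensor_map g ∘ tensor_map f.
Proof.
by rewrite /tensor_map /pm_hom /posm /negm /= !expom_comp !prdm_comp.
Qed.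

Definition pm_tensor : functor (prod_cat pm_cat pm_cat) pm_cat :=
  Functor tensor_map_id tensor_map_comp.

Definition ihom_ob (PQ : prod_cat (op_cat pm_cat) pm_cat) : pm_cat :=
  pm_ob (ihom_initial PQ.1 PQ.2).

(* [fg.1] is a morphism [B.1 → A.1] of [pm_cat]. *)
Definition ihom_map (A B : prod_cat (op_cat pm_cat) pm_cat) (fg : hom A B) :
    hom (ihom_ob A) (ihom_ob B) :=
  let f : @hom pm_cat B.1 A.1 := fg.1 in
  let g : @hom pm_cat A.2 B.2 := fg.2 in
  @pm_hom (ihom_ob A) (ihom_ob B)
    (prdm (expom (posm f) (posm g)) (expom (negm g) (negm f)))
    (prdm (posm f) (negm g)).

Lemma ihom_map_id A : ihom_map (idm A) = idm (ihom_ob A).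
Proof.
by rewrite /ihom_map /pm_hom /posm /negm /= !expom_id !prdm_id.
Qed.

Lemma ihom_map_comp (A B E : prod_cat (op_cat pm_cat) pm_cat) (g : hom B E)
    (f : hom A B) :
  ihom_map (g ∘ f) = ihom_map g ∘ ihom_map f.
Proof.
by rewrite /ihom_map /pm_hom /posm /negm /= !expom_comp !prdm_comp.
Qed.

Definition pm_ihom : functor (prod_cat (op_cat pm_cat) pm_cat) pm_cat :=
  Functor ihom_map_id ihom_map_comp.

End PlusMinus.

(** * Closed symmetric monoidal and [*]-autonomous categories *)

Section StarAutonomous.
Variables (C : category) (T : functor (prod_cat C C) C) (I : C)
  (J : functor (prod_cat (op_cat C) C) C).

Definition tens (A B : C) : C := T (A, B).
Definition tensm (A B A' B' : C) (f : hom A A') (g : hom B B') :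
    hom (tens A B) (tens A' B') :=
  @fmap _ _ T (A, B) (A', B') (f, g).
Definition ihom (A B : C) : C := J (A, B).
Definition ihomm (A B A' B' : C) (f : hom A' A) (g : hom B B') :
    hom (ihom A B) (ihom A' B') :=
  @fmap _ _ J (A, B) (A', B') (f, g).

Local Notation "A ⊗ B" := (tens A B) (at level 40, left associativity).
Local Notation "f ⊗m g" := (tensm f g) (at level 40, left associativity).
Local Notation "A ⊸ B" := (ihom A B) (at level 55, right associativity).

Record symmetric_monoidal : Type := SymmetricMonoidal {
  assoc : forall A B D, hom ((A ⊗ B) ⊗ D) (A ⊗ (B ⊗ D));
  assoc_iso : forall A B D, is_iso (assoc A B D);
  assoc_nat : forall A B D A' B' D'
      (f : hom A A') (g : hom B B') (h : hom D D'),
    assoc A' B' D' ∘ ((f ⊗m g) ⊗m h) = (f ⊗m (g ⊗m h)) ∘ assoc A B D;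
  lunit : forall A, hom (I ⊗ A) A;
  lunit_iso : forall A, is_iso (lunit A);
  lunit_nat : forall A A' (f : hom A A'),
    lunit A' ∘ (idm I ⊗m f) = f ∘ lunit A;
  runit : forall A, hom (A ⊗ I) A;
  runit_iso : forall A, is_iso (runit A);
  runit_nat : forall A A' (f : hom A A'),
    runit A' ∘ (f ⊗m idm I) = f ∘ runit A;
  pentagon : forall A B D E,
    assoc A B (D ⊗ E) ∘ assoc (A ⊗ B) D E =
    (idm A ⊗m assoc B D E) ∘ assoc A (B ⊗ D) E ∘ (assoc A B D ⊗m idm E);
  triangle : forall A B,
    (idm A ⊗m lunit B) ∘ assoc A I B = runit A ⊗m idm B;
  swap : forall A B, hom (A ⊗ B) (B ⊗ A);
  swap_nat : forall A B A' B' (f : hom A A') (g : hom B B'),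
    swap A' B' ∘ (f ⊗m g) = (g ⊗m f) ∘ swap A B;
  swap_swap : forall A B, swap B A ∘ swap A B = idm (A ⊗ B);
  hexagon : forall A B D,
    assoc B D A ∘ swap A (B ⊗ D) ∘ assoc A B D =
    (idm B ⊗m swap A D) ∘ assoc B A D ∘ (swap A B ⊗m idm D)
}.

Record closed_symmetric_monoidal : Type := ClosedSymmetricMonoidal {
  csm_sm :> symmetric_monoidal;
  curry : forall A B D, hom (A ⊗ B) D -> hom A (B ⊸ D);
  uncurry : forall A B D, hom A (B ⊸ D) -> hom (A ⊗ B) D;
  curryK : forall A B D (f : hom (A ⊗ B) D), uncurry (curry f) = f;
  uncurryK : forall A B D (f : hom A (B ⊸ D)), curry (uncurry f) = f;
  curry_nat : forall A B D A' B' D'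
      (f : hom A' A) (g : hom B' B) (h : hom D D') (k : hom (A ⊗ B) D),
    curry (h ∘ k ∘ (f ⊗m g)) = ihomm g h ∘ curry k ∘ f
}.

(** The transpose of [A ⊗ (A ⊸ bot) → (A ⊸ bot) ⊗ A → bot], the second map
    being evaluation, i.e. the counit of the adjunction. *)
Definition double_dual (M : closed_symmetric_monoidal) (bot A : C) :
    hom A ((A ⊸ bot) ⊸ bot) :=
  curry M (uncurry M (idm (A ⊸ bot)) ∘ swap M A (A ⊸ bot)).

Record star_autonomous (bot : C) : Type := StarAutonomous {
  sa_csm :> closed_symmetric_monoidal;
  double_dual_iso : forall A, is_iso (double_dual sa_csm bot A)
}.

Definition semicartesian (M : symmetric_monoidal) : Prop := is_terminal I.

End StarAutonomous.

(* Main.v *)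
Require Import Defs.
From Corelib Require Import ssreflect ssrfun.
From Stdlib Require Import IndefiniteDescription.

Set Implicit Arguments.
Unset Strict Implicit.
Unset Printing Implicit Defensive.

Local Open Scope cat_scope.

(** An object [P] of [H±] is a proposition with a proof part [pos P] and a
    refutation part [neg P] that contradict each other.  As there is at most
    one map [pos P ∧ neg P → zero], and there is one exactly when the two parts
    are disjoint, [H±] is the Chu construction on [H] with dualizing object
    [zero].  The negative part of a Chu tensor product is in general a pullback
    over [pos P ∧ pos Q ⇒ zero]: it consists of pairs of maps
    [pos P ⇒ neg Q], [pos Q ⇒ neg P] that induce the same pairing with
    [pos P ∧ pos Q].  Since the initial object of a cartesian closed category
    is strict, any two maps into [zero] are equal ([zero_ext]), so the
    compatibility condition is void and the pullback is a plain product.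

    Consequently both components of every structural map are terms of the
    typed lambda calculus with products, and each coherence law is an equation
    between such terms that holds by beta, eta, and the fact that all maps into
    [one] or into [zero] coincide.  These equations are proved uniformly by
    evaluating both sides at generalized elements ([elt_ext], [expo_ext]) and
    computing with the rewrite rules [eltE].

    Disjointness of [pos P] and [neg P] supplies maps
    [neg P → (pos P ⇒ zero)] ([refute]).  They make the factor [pos P ⇒ zero]
    redundant in the products where it occurs beside [neg P]: [neg (pm_top ⊠ P)] and [pos (P ⊸ pm_bot)]
    are then both isomorphic to [neg P], which gives the unitors and the inverse
    of the double-dualization map.  Finally [pm_top] is
    terminal because its components [one] and [zero] are terminal and initial
    in [H]. *)

(** * Computing with generalized elements *)

Section GeneralizedElements.
Variable H : cartesian_closed_category.
Implicit Types A B X Y : H.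

Local Notation app f a := (ev ∘ pairm f a).

(** The Yoneda principle.  Composing with an arbitrary [x] is what lets the
    rewrite rules below assume that every map stands to the left of an
    element. *)
Lemma elt_ext X A (f g : hom X A) :
  (forall Y (x : hom Y X), f ∘ x = g ∘ x) -> f = g.
Proof. by move=> /(_ X (idm X)); rewrite !comp_idr. Qed.

Lemma expo_ext X A B (f g : hom X (A ⇒ B)) :
  (forall Y (x : hom Y X) (a : hom Y A), app (f ∘ x) a = app (g ∘ x) a) ->
  f = g.
Proof.
move=> e; apply: lam_ext; rewrite /prdm !comp_idl; exact: e.
Qed.

(** Choosing the argument [to_one Y] instead of a variable keeps the elements
    of [one] in a single normal form. *)
Lemma expo_one_ext X B (f g : hom X (one ⇒ B)) :
  (forall Y (x : hom Y X), app (f ∘ x) (to_one Y) = app (g ∘ x) (to_one Y)) ->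
  f = g.
Proof. by move=> e; apply: expo_ext => Y x a; rewrite (to_one_uniq a). Qed.

Lemma one_ext X (f g : hom X one) : f = g.
Proof. by rewrite (to_one_uniq f) (to_one_uniq g). Qed.

Lemma compA A B X Y (h : hom X Y) (g : hom B X) (f : hom A B) :
  h ∘ g ∘ f = h ∘ (g ∘ f).
Proof. by rewrite comp_assoc. Qed.

(** Beta reduction, with the closure [x] of the abstraction made explicit; it
    performs the substitution under [lam] that makes a separate rule for
    [lam f ∘ x] unnecessary. *)
Lemma app_lam X Y A B (f : hom (X ∧ A) B) (x : hom Y X) (a : hom Y A) :
  app (lam f ∘ x) a = f ∘ pairm x a.
Proof.
by rewrite -{2}(ev_lam f) compA pairm_comp !compA fst_pairm snd_pairm.
Qed.

Lemma app_expom X A B A' B' (f : hom A' A) (g : hom B B')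
    (x : hom X (A ⇒ B)) (a : hom X A') :
  app (expom f g ∘ x) a = g ∘ app x (f ∘ a).
Proof.
by rewrite app_lam /prdm !compA pairm_comp !compA fst_pairm snd_pairm
  comp_idl.
Qed.

Lemma prdm_elt X A B A' B' (f : hom A A') (g : hom B B') (x : hom X (A ∧ B)) :
  prdm f g ∘ x = pairm (f ∘ (fst_ ∘ x)) (g ∘ (snd_ ∘ x)).
Proof. by rewrite /prdm pairm_comp !compA. Qed.

Lemma pairm_eta X A B (x : hom X (A ∧ B)) :
  pairm (fst_ ∘ x) (snd_ ∘ x) = x.
Proof. by symmetry; apply: pairm_uniq. Qed.

Lemma to_one_elt X Y (x : hom Y X) : to_one X ∘ x = to_one Y.
Proof. exact: to_one_uniq. Qed.

(** Eta for [one], in the only form in which a compound element of [one] occurs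
    in the coherence laws: a projection from [pos P ∧ one]. *)
Lemma snd_one A : snd_ = to_one (A ∧ one).
Proof. exact: to_one_uniq. Qed.

(** Oriented so that a composite applied to an element becomes a nest of
    projections and applications, the beta-eta normal form of the term up to
    eta for functions; the latter is left to [expo_ext]. *)
Definition eltE := (compA, comp_idl, prdm_elt, pairm_comp, app_lam,
  app_expom, fst_pairm, snd_pairm, pairm_eta, to_one_elt, snd_one).

End GeneralizedElements.

(** A map into [zero] makes its source initial, as [zero] is strict. *)
Lemma zero_ext (H : bicartesian_closed_category) (X : H) (f g : hom X zero) :
  f = g.
Proof.
by have [h [_ u]] := initial_of_hom f zero; rewrite -(u f) // -(u g).
Qed.

(** One extensionality step, driven by the type of the two elements compared,
    followed by normalization. *)
Ltac elt_step :=
  first [ exact: one_ext | exact: zero_ext | apply: pairm_ext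
        | apply: expo_one_ext => ? ? | apply: expo_ext => ? ? ? ];
  rewrite ?eltE.

Ltac elt_ext := apply: elt_ext => ? ?; rewrite ?eltE //; repeat elt_step => //.

(** * The structural maps of [H±] *)

Section PlusMinusStructure.
Variable H : bicartesian_closed_category.
Implicit Types P Q R S : pm_cat H.

Local Notation app f a := (ev ∘ pairm f a).
Local Notation "P ⊠ Q" := (tens (pm_tensor H) P Q)
  (at level 40, left associativity).
Local Notation "P ⊸ Q" := (ihom (pm_ihom H) P Q)
  (at level 55, right associativity).
Local Notation "f ⊠m g" := (tensm (pm_tensor H) f g)
  (at level 40, left associativity).

Lemma pm_ext P Q (f g : hom P Q) :
  posm f = posm g -> negm f = negm g -> f = g.
Proof. by case: f g => [f1 f2] [g1 g2]; rewrite /posm /negm /= => -> ->. Qed.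

(** The objects of [H±] only assert that a unique such map exists, so naming
    it requires a choice principle. *)
Definition refute P : hom (pos P ∧ neg P) zero :=
  proj1_sig (constructive_indefinite_description _ (proj2_sig P zero)).

(** On either side the negative part consists of three maps that produce a
    refutation of one factor from proofs of the other two:
    [pos P, pos Q ⊢ neg R], [pos P, pos R ⊢ neg Q] and
    [pos Q, pos R ⊢ neg P].  The bracketing only affects how they are curried
    and paired, and the negative components below translate between the two
    presentations. *)
Definition pm_assoc P Q R : hom ((P ⊠ Q) ⊠ R) (P ⊠ (Q ⊠ R)) :=
  @pm_hom H ((P ⊠ Q) ⊠ R) (P ⊠ (Q ⊠ R))
    (pairm (fst_ ∘ fst_) (pairm (snd_ ∘ fst_) snd_))
    (pairm
      (lam (app (fst_ ∘ (app (fst_ ∘ fst_) (fst_ ∘ snd_))) (snd_ ∘ snd_)))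
      (lam (pairm
        (lam (app (snd_ ∘ app (fst_ ∘ (fst_ ∘ fst_)) snd_) (snd_ ∘ fst_)))
        (lam (app (snd_ ∘ (fst_ ∘ fst_)) (pairm snd_ (snd_ ∘ fst_))))))).

Definition pm_assoc_inv P Q R : hom (P ⊠ (Q ⊠ R)) ((P ⊠ Q) ⊠ R) :=
  @pm_hom H (P ⊠ (Q ⊠ R)) ((P ⊠ Q) ⊠ R)
    (pairm (pairm fst_ (fst_ ∘ snd_)) (snd_ ∘ snd_))
    (pairm
      (lam (pairm
        (lam (app (fst_ ∘ (fst_ ∘ fst_)) (pairm (snd_ ∘ fst_) snd_)))
        (lam (app (fst_ ∘ app (snd_ ∘ (fst_ ∘ fst_)) snd_) (snd_ ∘ fst_)))))
      (lam (app (snd_ ∘ (app (snd_ ∘ fst_) (snd_ ∘ snd_))) (fst_ ∘ snd_)))).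

Definition pm_swap P Q : hom (P ⊠ Q) (Q ⊠ P) :=
  @pm_hom H (P ⊠ Q) (Q ⊠ P) (pairm snd_ fst_) (pairm snd_ fst_).

(** A refutation of [pm_top ⊠ P] is a constant refutation of [P] together with
    a map [pos P ⇒ zero]; the latter carries no information beyond the former,
    which yields it by [refute]. *)
Definition pm_lunit P : hom (pm_top H ⊠ P) P :=
  @pm_hom H (pm_top H ⊠ P) P snd_
    (pairm (lam fst_) (lam (refute P ∘ pairm snd_ fst_))).

Definition pm_lunit_inv P : hom P (pm_top H ⊠ P) :=
  @pm_hom H P (pm_top H ⊠ P) (pairm (to_one _) (idm _))
    (app fst_ (to_one _)).

Definition pm_runit P : hom (P ⊠ pm_top H) P :=
  @pm_hom H (P ⊠ pm_top H) P fst_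
    (pairm (lam (refute P ∘ pairm snd_ fst_)) (lam fst_)).

Definition pm_runit_inv P : hom P (P ⊠ pm_top H) :=
  @pm_hom H P (P ⊠ pm_top H) (pairm (idm _) (to_one _))
    (app snd_ (to_one _)).

(** A map [P ⊠ Q → R] amounts to three maps in [H]:
    [pos P, pos Q ⊢ pos R], [pos P, neg R ⊢ neg Q] and
    [pos Q, neg R ⊢ neg P].  So does a map [P → Q ⊸ R]; it groups the first two
    in its positive component, where the tensor groups the last two in its
    negative one. *)
Definition pm_curry P Q R (f : hom (P ⊠ Q) R) : hom P (Q ⊸ R) :=
  @pm_hom H P (Q ⊸ R)
    (pairm (lam (posm f)) (lam (app (fst_ ∘ (negm f ∘ snd_)) fst_)))
    (app (snd_ ∘ (negm f ∘ snd_)) fst_).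

Definition pm_uncurry P Q R (f : hom P (Q ⊸ R)) : hom (P ⊠ Q) R :=
  @pm_hom H (P ⊠ Q) R
    (app (fst_ ∘ (posm f ∘ fst_)) snd_)
    (pairm (lam (app (snd_ ∘ (posm f ∘ snd_)) fst_))
           (lam (negm f ∘ pairm snd_ fst_))).

(** * Coherence *)

(** The objects are split into pairs so that the types of both components
    reduce to explicit products and exponentials, on which [elt_step] acts. *)
Ltac pm_solve :=
  repeat match goal with P : ob (pm_cat _) |- _ => destruct P as [[? ?] ?] end;
  apply: pm_ext; rewrite /posm /negm /pos /neg; cbn; rewrite /pos /neg /=;
  elt_ext.

Lemma pm_assoc_iso P Q R : is_iso (pm_assoc P Q R).
Proof. by exists (pm_assoc_inv P Q R); split; pm_solve. Qed.

Lemma pm_assoc_nat P Q R P' Q' R'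
    (f : hom P P') (g : hom Q Q') (h : hom R R') :
  pm_assoc P' Q' R' ∘ ((f ⊠m g) ⊠m h) = (f ⊠m (g ⊠m h)) ∘ pm_assoc P Q R.
Proof. pm_solve. Qed.

Lemma pm_lunit_iso P : is_iso (pm_lunit P).
Proof. exists (pm_lunit_inv P); split; pm_solve. Qed.

Lemma pm_lunit_nat P P' (f : hom P P') :
  pm_lunit P' ∘ (idm (pm_top H) ⊠m f) = f ∘ pm_lunit P.
Proof. pm_solve. Qed.

Lemma pm_runit_iso P : is_iso (pm_runit P).
Proof. exists (pm_runit_inv P); split; pm_solve. Qed.

Lemma pm_runit_nat P P' (f : hom P P') :
  pm_runit P' ∘ (f ⊠m idm (pm_top H)) = f ∘ pm_runit P.
Proof. pm_solve. Qed.

Lemma pm_pentagon P Q R S :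
  pm_assoc P Q (R ⊠ S) ∘ pm_assoc (P ⊠ Q) R S =
  (idm P ⊠m pm_assoc Q R S) ∘ pm_assoc P (Q ⊠ R) S ∘ (pm_assoc P Q R ⊠m idm S).
Proof. pm_solve. Qed.

Lemma pm_triangle P Q :
  (idm P ⊠m pm_lunit Q) ∘ pm_assoc P (pm_top H) Q = pm_runit P ⊠m idm Q.
Proof. pm_solve. Qed.

Lemma pm_swap_nat P Q P' Q' (f : hom P P') (g : hom Q Q') :
  pm_swap P' Q' ∘ (f ⊠m g) = (g ⊠m f) ∘ pm_swap P Q.
Proof. pm_solve. Qed.

Lemma pm_swap_swap P Q : pm_swap Q P ∘ pm_swap P Q = idm (P ⊠ Q).
Proof. pm_solve. Qed.

Lemma pm_hexagon P Q R :
  pm_assoc Q R P ∘ pm_swap P (Q ⊠ R) ∘ pm_assoc P Q R =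
  (idm Q ⊠m pm_swap P R) ∘ pm_assoc Q P R ∘ (pm_swap P Q ⊠m idm R).
Proof. pm_solve. Qed.

Definition pm_symmetric_monoidal :
    symmetric_monoidal (pm_tensor H) (pm_top H) :=
  SymmetricMonoidal pm_assoc_iso pm_assoc_nat pm_lunit_iso pm_lunit_nat
    pm_runit_iso pm_runit_nat pm_pentagon pm_triangle pm_swap_nat
    pm_swap_swap pm_hexagon.

Lemma pm_curryK P Q R (f : hom (P ⊠ Q) R) : pm_uncurry (pm_curry f) = f.
Proof. pm_solve. Qed.

Lemma pm_uncurryK P Q R (f : hom P (Q ⊸ R)) : pm_curry (pm_uncurry f) = f.
Proof. pm_solve. Qed.

Lemma pm_curry_nat P Q R P' Q' R'
    (f : hom P' P) (g : hom Q' Q) (h : hom R R') (k : hom (P ⊠ Q) R) :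
  pm_curry (h ∘ k ∘ (f ⊠m g)) = ihomm (pm_ihom H) g h ∘ pm_curry k ∘ f.
Proof. pm_solve. Qed.

Definition pm_closed_symmetric_monoidal :
    closed_symmetric_monoidal (pm_tensor H) (pm_top H) (pm_ihom H) :=
  ClosedSymmetricMonoidal pm_symmetric_monoidal pm_curryK pm_uncurryK
    pm_curry_nat.

(** * Duality *)

(** The positive part of [(P ⊸ pm_bot) ⊸ pm_bot] is
    [(pos (P ⊸ pm_bot) ⇒ zero) ∧ (one ⇒ pos P ∧ one)]: the proof of [P] is
    read off the second factor, and the first is then determined by
    [zero_ext].  In the other direction a refutation of [P] is completed to a
    proof of [P ⊸ pm_bot] by [refute]. *)
Definition pm_double_dual_inv P : hom ((P ⊸ pm_bot H) ⊸ pm_bot H) P :=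
  @pm_hom H ((P ⊸ pm_bot H) ⊸ pm_bot H) P
    (fst_ ∘ app snd_ (to_one _))
    (pairm (pairm (lam (refute P ∘ pairm snd_ fst_)) (lam fst_)) (to_one _)).

Lemma pm_double_dual_iso P :
  is_iso (double_dual pm_closed_symmetric_monoidal (pm_bot H) P).
Proof. exists (pm_double_dual_inv P); split; pm_solve. Qed.

Lemma pm_top_terminal : is_terminal (pm_top H).
Proof.
move=> P; exists (@pm_hom H P (pm_top H) (to_one _) (from_zero _)).
split=> // f _; apply: pm_ext; first exact: one_ext.
by rewrite (from_zero_uniq (negm f)).
Qed.

End PlusMinusStructure.

Theorem lemma3p5 (H : bicartesian_closed_category) :
  exists A : star_autonomous (pm_tensor H) (pm_top H) (pm_ihom H) (pm_bot H),
    semicartesian A.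
Proof.
exists (StarAutonomous (@pm_double_dual_iso H)).
exact: pm_top_terminal.
Qed.
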